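(* Let $d\ge 2$. If $G_P$ is a finitely constrained subgroup of $\mathrm{Aut}(X^* )$ defined by patterns of size $d$ with $\mathrm{Hdim}(G_P)=1-\frac{2}{2^{d-1}}$, then $G_P$ has additive portraits.
   Context: Let $X=\{0,1\}$ and let $X^*$ be the set of finite words over $X$, viewed as the rooted binary tree. $G=\mathrm{Aut}(X^* )$, and $G(d)$ is the automorphism group of the finite tree of words of length $\le d$. For $g\in G$ and $w\in X^*$ the section $g_w$ is defined by $g(wv)=g(w)g_w(v)$ (finite sections of elements of $G(d)$ likewise). $\pi_k$ denotes restriction to words of length $\le k$. $C_2=\{\mathrm{id},\sigma\}$ is written additively; $\alpha(g)=\sigma$ if $g(0)=1$ and $\mathrm{id}$ otherwise, and $\alpha_{(w)}(g)=\alpha(g_w)$. A subgroup $P\le G(d)$ is an essential pattern group if for every $p\in P$ and $i\in\{0,1\}$ there is $q\in P$ with $\pi_{d-1}(q)=p_i$; then $G_P=\{g\in G:\pi_d(g_w)\in P\ \forall w\in X^*\}$. Such groups are finitely constrained; defined by patterns of size $d$ means $d$ is minimal. $\mathrm{Hdim}(K)=\liminf_n \log_2|K(n)|/\log_2|G(n)|$ with $K(n)=\pi_n(K)$. The portrait map $\rho:G\to C_2^{X^*}$ is $\rho(g)_{(w)}=\alpha_{(w)}(g)$. A subgroup $H\le G$ has additive portraits if $\rho(H)$ is a subgroup of $C_2^{X^*}$ under pointwise addition. *)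

(* Defs.v *)
From Stdlib Require Import Reals ClassicalEpsilon.
From mathcomp Require Import all_boot fingroup perm.

Set Implicit Arguments.
Unset Strict Implicit.
Unset Printing Implicit Defensive.

(* X = {0,1} is encoded by bool (false = 0, true = 1); X^* = seq bool. *)

Fixpoint words_upto (d : nat) : seq (seq bool) :=
  match d with
  | 0 => [:: [::]]
  | d'.+1 => [::] :: [seq b :: w | b <- [:: false; true], w <- words_upto d']
  end.

Lemma mem_cons_map (b c : bool) (w : seq bool) (s : seq (seq bool)) :
  (b :: w \in [seq c :: u | u <- s]) = (b == c) && (w \in s).
Proof.
apply/mapP/andP => [[u us [-> ->]]|[/eqP -> ws]]; last by exists w.
by [].
Qed.

Lemma mem_words_upto d w : (w \in words_upto d) = (size w <= d).
Proof.
elim: d w => [|d IH] [|b w] //=.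
rewrite in_cons /= !mem_cat !mem_cons_map ltnS -IH.
by case: b; rewrite /= ?orbF.
Qed.

Definition W (d : nat) := seq_sub (words_upto d).

Definition Gd (d : nat) : {set {perm W d}} :=
  [set s : {perm W d} |
     [forall x : W d, size (val (s x)) == size (val x)] &&
     [forall x : W d, forall y : W d,
        prefix (val x) (val y) ==> prefix (val (s x)) (val (s y))]].

Definition actf d (p : {perm W d}) (w : seq bool) : seq bool :=
  match (insub w : option (W d)) with
  | Some x => val (p x)
  | None => w
  end.

Definition isAut (g : seq bool -> seq bool) : Prop :=
  bijective g /\
  (forall w, size (g w) = size w) /\
  (forall w v, take (size w) (g (w ++ v)) = g w).

(* section g_w : g (w v) = g(w) g_w(v) *)
Definition sec (g : seq bool -> seq bool) (w : seq bool) : seq bool -> seq bool :=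
  fun v => drop (size w) (g (w ++ v)).

(* alpha(g) = sigma (encoded as true) iff g(0) = 1 *)
Definition alpha (g : seq bool -> seq bool) : bool := g [:: false] == [:: true].

(* portrait rho(g)_(w) = alpha(g_w); C_2 encoded by bool with addition xorb *)
Definition rho (g : seq bool -> seq bool) (w : seq bool) : bool := alpha (sec g w).

(* P <= G(d) essential: for p in P, i in X, some q in P has pi_{d-1}(q) = p_i *)
Definition essential d (P : {group {perm W d}}) : Prop :=
  forall p, p \in P -> forall i : bool,
    exists2 q, q \in P &
      forall u, size u <= d.-1 -> actf q u = drop 1 (actf p (i :: u)).

Definition GP d (P : {group {perm W d}}) (g : seq bool -> seq bool) : Prop :=
  isAut g /\
  forall w, exists2 p, p \in P & forall u, size u <= d -> actf p u = sec g w u.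

Definition minimal_size d (P : {group {perm W d}}) : Prop :=
  forall d', 1 <= d' < d ->
    forall P' : {group {perm W d'}}, P' \subset Gd d' -> essential P' ->
      ~ (forall g, GP P' g <-> GP P g).

Definition asb (Q : Prop) : bool :=
  if excluded_middle_informative Q then true else false.

Definition Kn (K : (seq bool -> seq bool) -> Prop) (n : nat) : {set {perm W n}} :=
  [set s : {perm W n} | (s \in Gd n) &&
     asb (exists g, K g /\ forall u, size u <= n -> actf s u = g u)].

Local Open Scope R_scope.

Definition log2 (x : R) : R := ln x / ln 2.

Definition hdim_seq (K : (seq bool -> seq bool) -> Prop) (n : nat) : R :=
  (log2 (INR #|Kn K n|) / log2 (INR #|Gd n|)).

Definition is_liminf (a : nat -> R) (l : R) : Prop :=
  (forall eps : R, (0 < eps) -> exists N, forall n, (N <= n)%N -> (l - eps < a n)) /\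
  (forall eps : R, (0 < eps) -> forall N, exists n, (N <= n)%N /\ (a n < l + eps)).

Definition Hdim_is (K : (seq bool -> seq bool) -> Prop) (l : R) : Prop :=
  is_liminf (hdim_seq K) l.

(* rho(H) is a subgroup of C_2^{X^*} under pointwise addition
   (in C_2 every element is its own negative, so closure under addition and
   containing 0 is the subgroup condition) *)
Definition additive_portraits (H : (seq bool -> seq bool) -> Prop) : Prop :=
  (exists g, H g /\ forall w, rho g w = false) /\
  (forall g h, H g -> H h ->
     exists k, H k /\ forall w, rho k w = xorb (rho g w) (rho h w)).

(* Main.v *)
Require Import Defs.
From Stdlib Require Import Reals ClassicalEpsilon FunctionalExtensionality.
From Stdlib Require Import PropExtensionality Lra.
From mathcomp Require Import all_boot fingroup perm.
From mathcomp Require Import zify.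

(* Counting level by level, a group defined by an essential pattern group P of
   size d = m + 1 has log2 |G_P(k + m)| = log2 |Q| + (2^k - 1) log2 |K|, where
   Q is the projection of P to G(m) and K is the kernel of P -> Q.  The
   prescribed dimension therefore means |K| = 2^(2^m - 2), i.e. K has index 4
   in the group C_2^(X^m) of all last-level patterns.  Let K_Q be the
   last-level kernel of Q.  Then K lies in K_Q x K_Q; if K_Q is proper, counting
   forces equality and G_P = G_Q, against the minimality of d.  So K_Q
   is full, which propagates upwards and gives Q = G(m).

   Now K is an index 4 subspace of C_2^(X^m) invariant under all of G(m), and
   the only one consists of the patterns whose sums S_0, S_1 over the words
   below 0 and below 1 both vanish.  Hence P is cut out by equations
   S_i(p) = phi_i(pi_m(p)), where phi is a cocycle of G(m) with values in
   C_2^2.  On the stabilizer of level 1 each phi_i is a homomorphism to C_2, and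
   homomorphisms from G(n) to C_2 are additive in portraits, so phi
   is additive in portraits and P is closed under their addition. *)

Set Implicit Arguments.
Unset Strict Implicit.
Unset Printing Implicit Defensive.

(** * Portraits *)

(* Automorphisms are handled through their portraits: [act f] is the automorphism
   with portrait [f], and a pattern of size d is the restriction of a portrait to
   the words of length < d, i.e. a class of [eqport d]. *)
Definition port := seq bool -> bool.

Definition branch (f : port) (b : bool) : port := fun w => f (b :: w).

Definition below (f : port) (w : seq bool) : port := fun v => f (w ++ v).

Definition eqport (n : nat) (f g : port) : Prop :=
  forall w, size w < n -> f w = g w.

Fixpoint act (f : port) (u : seq bool) : seq bool :=
  if u is b :: w then (b (+) f [::]) :: act (branch f b) w else [::].

Fixpoint iact (f : port) (u : seq bool) : seq bool :=
  if u is b :: w then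
    (b (+) f [::]) :: iact (branch f (b (+) f [::])) w
  else [::].

(* [pmul f g] is the portrait of [act f \o act g]. *)
Definition pone : port := fun=> false.
Definition padd (f g : port) : port := fun w => f w (+) g w.
Definition pmul (f g : port) : port := fun w => f (act g w) (+) g w.
Definition pinv (f : port) : port := fun w => f (iact f w).

Lemma size_act f u : size (act f u) = size u.
Proof. by elim: u f => //= b u IH f; rewrite IH. Qed.

Lemma size_iact f u : size (iact f u) = size u.
Proof. by elim: u f => //= b u IH f; rewrite IH. Qed.

Lemma act_cat f w v : act f (w ++ v) = act f w ++ act (below f w) v.
Proof. by elim: w f => //= b w IH f; rewrite IH. Qed.

Lemma actK f : cancel (act f) (iact f).
Proof. by move=> u; elim: u f => //= b u IH f; rewrite addbK IH. Qed.

Lemma iactK f : cancel (iact f) (act f).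
Proof. by move=> u; elim: u f => //= b u IH f; rewrite addbK IH. Qed.

Lemma act_inj f : injective (act f).
Proof. exact: can_inj (actK f). Qed.

Lemma eqport_act n f g u : eqport n f g -> size u <= n -> act f u = act g u.
Proof.
elim: u n f g => //= b u IH [//|n] f g fg un.
by rewrite (fg [::]) // (IH n _ (branch g b)) // => w wn; apply: fg.
Qed.

Lemma act_one u : act pone u = u.
Proof. by elim: u => //= b u IH; rewrite addbF -[branch pone b]/pone IH. Qed.

Lemma act_mul f g u : act (pmul f g) u = act f (act g u).
Proof.
elim: u f g => //= b u IH f g; rewrite -IH; congr (_ :: _).
by rewrite /pmul /= -addbA [f _ (+) _]addbC.
Qed.

Lemma act_inv f u : act (pinv f) u = iact f u.
Proof.
elim: u f => //= b u IH f; rewrite -IH; congr (_ :: _).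
Qed.

Lemma rho_act f : rho (act f) =1 f.
Proof.
move=> w; rewrite /rho /alpha /sec act_cat drop_size_cat ?size_act //=.
by rewrite /below cats0; case: (f w).
Qed.

Lemma act_eqport n f g :
  (forall u, size u <= n -> act f u = act g u) -> eqport n f g.
Proof.
move=> fg w wn; rewrite -rho_act -[RHS]rho_act /rho /alpha /sec.
by rewrite fg // size_cat /= addn1.
Qed.

Lemma act_isAut f : isAut (act f).
Proof.
split; first by exists (iact f); [exact: actK | exact: iactK].
split=> [w|w v]; first exact: size_act.
by rewrite act_cat take_size_cat // size_act.
Qed.

Lemma sec_act f w u : sec (act f) w u = act (below f w) u.
Proof. by rewrite /sec act_cat drop_size_cat // size_act. Qed.

(** Both children of [u] go to children of [g u], and injectivity gives them different last letters,
    so the label [rho g u] fixes both images. The bound [n] lets the lemma serve infinite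
    automorphisms and permutations of a finite tree alike. *)
Lemma local_act_rho n (g : seq bool -> seq bool) :
  (forall w, size w <= n -> size (g w) = size w) ->
  (forall w v, size (w ++ v) <= n -> take (size w) (g (w ++ v)) = g w) ->
  (forall w v, size w <= n -> size v <= n -> g w = g v -> w = v) ->
  forall u, size u <= n -> g u = act (rho g) u.
Proof.
move=> gs gt gi; elim/last_ind => [|u b IH] un.
  by have /size0nil -> := gs [::] isT.
have un' : size u <= n by apply: leq_trans un; rewrite size_rcons.
have ex c : exists e, g (rcons u c) = rcons (g u) e.
  have cn : size (rcons u c) <= n by move: un; rewrite !size_rcons.
  case/lastP E: (g (rcons u c)) => [|x e].
    by have := gs _ cn; rewrite E size_rcons.
  exists e; have := gs _ cn; rewrite E !size_rcons => -[sx].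
  have := gt u [:: c]; rewrite cats1 => /(_ cn).
  by rewrite E -cats1 take_cat sx ltnn subnn take0 cats0 => ->; rewrite cats1.
have [e0 E0] := ex false; have [e1 E1] := ex true.
have e01 : e0 != e1.
  apply/eqP => e; have : rcons u false = rcons u true.
    by apply: gi; rewrite ?size_rcons // -?(size_rcons u b) // E0 E1 e.
  by move/rcons_inj.
have r : rho g u = e0.
  rewrite /rho /alpha /sec cats1 E0 -cats1 drop_size_cat ?gs //.
  by case: (e0).
rewrite -[in RHS]cats1 act_cat /= /below cats0 r -(IH un').
by case: b {un} => /=; rewrite ?E0 ?E1 cats1; case: (e0) (e1) e01 => [] [].
Qed.

Lemma isAut_act g : isAut g -> g = act (rho g).
Proof.
move=> [gb [gs gt]]; apply: functional_extensionality => u.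
apply: (@local_act_rho (size u)) => // w v _ _; exact: bij_inj.
Qed.

Lemma eqport_sym n f g : eqport n f g -> eqport n g f.
Proof. by move=> fg w /fg. Qed.

Lemma eqport_trans n f g h : eqport n f g -> eqport n g h -> eqport n f h.
Proof. by move=> fg gh w wn; rewrite fg ?gh. Qed.

Lemma eqport_mul n f f' g g' :
  eqport n f f' -> eqport n g g' -> eqport n (pmul f g) (pmul f' g').
Proof.
move=> ff gg w wn; rewrite /pmul (eqport_act gg (ltnW wn)) gg // ff //.
by rewrite size_act.
Qed.

Lemma pmul1p f : pmul pone f =1 f.
Proof. by move=> w. Qed.

Lemma pmulp1 f : pmul f pone =1 f.
Proof. by move=> w; rewrite /pmul act_one addbF. Qed.

Lemma pmulpV f : pmul f (pinv f) =1 pone.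
Proof. by move=> w; rewrite /pmul act_inv addbb. Qed.

Lemma pmulVp f : pmul (pinv f) f =1 pone.
Proof. by move=> w; rewrite /pmul /pinv actK addbb. Qed.

Lemma pmulKp f g : pmul (pinv f) (pmul f g) =1 g.
Proof. by move=> w; rewrite {1}/pmul act_mul /pinv actK /pmul addKb. Qed.

Lemma pmulVKp f g : pmul f (pmul (pinv f) g) =1 g.
Proof. by move=> w; rewrite {1}/pmul act_mul act_inv /pmul /pinv addKb. Qed.

Lemma pmul_cancel n f g h : eqport n (pmul f g) (pmul f h) -> eqport n g h.
Proof.
move=> gh w wn; rewrite -(pmulKp f g) -[RHS](pmulKp f h).
by apply: eqport_mul gh w wn => v.
Qed.

(** * Permutations of the finite trees *)

Lemma actfE n (s : {perm W n}) (x : W n) : actf s (val x) = val (s x).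
Proof. by rewrite /actf valK. Qed.

Lemma actf_perm n (s : {perm W n}) w (wn : w \in words_upto n) :
  actf s w = val (s (SeqSub wn)).
Proof. exact: (actfE s (SeqSub wn)). Qed.

Lemma GdP n (s : {perm W n}) :
  reflect (exists f, forall u, size u <= n -> actf s u = act f u) (s \in Gd n).
Proof.
rewrite inE; apply: (iffP andP) => [[/forallP ss /forallP sp]|[f sf]].
  exists (rho (actf s)); apply: local_act_rho => [w|w v|w v].
  - by rewrite -mem_words_upto => wn; rewrite actf_perm (eqP (ss _)).
  - move=> wvn; have wn : size w <= n.
      by apply: leq_trans wvn; rewrite size_cat leq_addr.
    move: wvn wn; rewrite -!mem_words_upto => wvn wn.
    rewrite !actf_perm; set x := SeqSub wn; set y := SeqSub wvn.
    have := sp x; move/forallP/(_ y)/implyP; rewrite /= prefix_prefix => /(_ isT).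
    by rewrite prefixE (eqP (ss x)) => /eqP.
  - rewrite -!mem_words_upto => wn vn; rewrite !actf_perm => /val_inj/perm_inj.
    by move/(congr1 val).
have sv (x : W n) : val (s x) = act f (val x).
  by rewrite -actfE sf // -mem_words_upto; apply: valP.
split; apply/forallP => x; first by rewrite sv size_act.
apply/forallP => y; apply/implyP; rewrite !sv => /prefixP [v ->].
by rewrite act_cat prefix_prefix.
Qed.

Lemma Gd_exists n f : exists2 s, s \in Gd n &
  forall u, size u <= n -> actf s u = act f u.
Proof.
have wact (x : W n) : act f (val x) \in words_upto n.
  by rewrite mem_words_upto size_act -mem_words_upto; apply: valP.
have inj : injective (fun x : W n => SeqSub (wact x) : W n).
  by move=> x y /(congr1 val) /= /act_inj /val_inj.
have E u : size u <= n -> actf (perm inj) u = act f u.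
  by rewrite -mem_words_upto => un; rewrite actf_perm permE.
by exists (perm inj) => //; apply/GdP; exists f.
Qed.

Definition pt n (s : {perm W n}) : port := rho (actf s).

Lemma act_pt n (s : {perm W n}) u :
  s \in Gd n -> size u <= n -> actf s u = act (pt s) u.
Proof.
case/GdP=> f sf un; rewrite sf //.
apply: (@eqport_act n) => // w wn; rewrite -rho_act /pt /rho /alpha /sec.
by rewrite sf // size_cat /= addn1.
Qed.

Lemma actf_inj n (s t : {perm W n}) :
  (forall u, size u <= n -> actf s u = actf t u) -> s = t.
Proof.
move=> st; apply/permP => x; apply: val_inj; rewrite -!actfE st //.
by rewrite -mem_words_upto; apply: valP.
Qed.

Lemma actfM n (s t : {perm W n}) u :
  size u <= n -> actf (s * t) u = actf t (actf s u).
Proof.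
by rewrite -mem_words_upto => un; rewrite !(actf_perm _ un) actfE permM.
Qed.

Lemma actf1 n u : size u <= n -> actf (1 : {perm W n}) u = u.
Proof. by rewrite -mem_words_upto => un; rewrite actf_perm perm1. Qed.

(** * Pattern groups and the count of their restrictions *)

Lemma asbP Q : reflect Q (asb Q).
Proof. by rewrite /asb; case: excluded_middle_informative => ?; constructor. Qed.

(** Closure under [eqport d] makes a predicate on infinite portraits stand for a set of patterns of
    size [d]. *)
Record pattern_group (d : nat) (P : port -> Prop) : Prop := PatternGroup {
  pg_eq : forall f g, eqport d f g -> P f -> P g;
  pg_one : P pone;
  pg_mul : forall f g, P f -> P g -> P (pmul f g);
  pg_inv : forall f, P f -> P (pinv f) }.

(** Classes of [eqport n] as a finite type, so that they can be counted: a root label and two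
    subtrees. *)
Fixpoint pattern (n : nat) : finType :=
  if n is k.+1 then (bool * (pattern k * pattern k))%type else unit.

Fixpoint tr (n : nat) (f : port) : pattern n :=
  match n with
  | 0 => tt
  | k.+1 => (f [::], (tr k (branch f false), tr k (branch f true)))
  end.

Fixpoint ext (n : nat) : pattern n -> port :=
  match n with
  | 0 => fun=> pone
  | k.+1 => fun t w =>
      if w is b :: v then ext (if b then t.2.2 else t.2.1) v else t.1
  end.

Lemma extK n (t : pattern n) : tr n (ext t) = t.
Proof.
elim: n t => [[]//|n IH] [e [a b]] /=.
by rewrite -[branch _ false]/(ext a) -[branch _ true]/(ext b) !IH.
Qed.

Lemma tr_eqP n f g : tr n f = tr n g <-> eqport n f g.
Proof.
elim: n f g => [|n IH] f g; first by split.
split=> [[f0 /IH fa /IH fb] [|[] w] //= wn|fg]; [exact: fb | exact: fa |].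
rewrite /= (fg [::]) //; congr (_, (_, _)); apply/IH => w wn; exact: fg.
Qed.

Lemma ext_tr n f : eqport n (ext (tr n f)) f.
Proof. by apply/tr_eqP; rewrite extK. Qed.

Lemma card_pattern n : #|pattern n| = 2 ^ (2 ^ n - 1).
Proof.
elim: n => [|n IH]; first by rewrite card_unit.
rewrite !card_prod card_bool IH -expnD -expnS; congr (_ ^ _).
by have := expn_gt0 2 n; rewrite expnS; lia.
Qed.

Definition patset n (P : port -> Prop) : {set pattern n} := [set t | asb (P (ext t))].

Lemma patsetP n P (t : pattern n) : reflect (P (ext t)) (t \in patset n P).
Proof. by rewrite inE; apply: asbP. Qed.

Definition proj (n : nat) (P : port -> Prop) : port -> Prop :=
  fun f => exists2 p, P p & eqport n p f.

Definition kernel (n : nat) (P : port -> Prop) : port -> Prop :=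
  fun f => P f /\ eqport n f pone.

Lemma tr_patset n P f : pattern_group n P -> (tr n f \in patset n P) <-> P f.
Proof.
move=> gP; split=> [/patsetP|fP]; first exact: (pg_eq gP (@ext_tr n f)).
apply/patsetP; exact: (pg_eq gP (eqport_sym (@ext_tr n f))).
Qed.

Lemma proj_group n P : pattern_group n.+1 P -> pattern_group n (proj n P).
Proof.
move=> gP; split=> [f g fg [p pP pf]||f g [p pP pf] [q qP qg]|f [p pP pf]].
- by exists p => //; apply: eqport_trans fg.
- by exists pone => //; apply: pg_one gP.
- by exists (pmul p q); [apply: pg_mul gP _ _ pP qP | apply: eqport_mul].
exists (pinv p); first exact: pg_inv gP _ pP.
apply: (@pmul_cancel n p) => w wn; rewrite pmulpV.
rewrite (eqport_mul pf (fun _ _ => erefl _) wn).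
by rewrite pmulpV.
Qed.

Lemma proj_in n (P : port -> Prop) f : P f -> proj n P f.
Proof. by exists f. Qed.

(** The essential condition on a pattern group of size [n.+1], read on portraits. *)
Definition self_similar (n : nat) (P : port -> Prop) : Prop :=
  forall f i, P f -> proj n P (branch f i).

Definition ker_card n P := #|patset n.+1 (kernel n P)|.

Section Count.
Variables (m : nat) (P : port -> Prop).
Hypothesis gP : pattern_group m.+1 P.
Hypothesis ssP : self_similar m P.

(** The fiber over [q] is a left coset [p0 K] of the kernel, for any [p0] in [P] above [q]. *)
Lemma card_fiber (q : pattern m) : q \in patset m (proj m P) ->
  #|[set p in patset m.+1 P | tr m (ext p) == q]| = ker_card m P.
Proof.
case/patsetP => p0 p0P p0q.
pose h (k : pattern m.+1) := tr m.+1 (pmul p0 (ext k)).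
have hinj : injective h.
  by move=> k l /tr_eqP /pmul_cancel /tr_eqP; rewrite !extK.
rewrite /ker_card -[RHS](card_imset _ hinj); congr #|pred_of_set _|.
apply/setP => p; rewrite inE; apply/andP/imsetP.
  move=> [/patsetP pP /eqP pq].
  exists (tr m.+1 (pmul (pinv p0) (ext p))); last first.
    rewrite -[LHS]extK /h; apply/tr_eqP => w wn.
    by rewrite (eqport_mul (fun _ _ => erefl (p0 _)) (@ext_tr m.+1 _) wn) pmulVKp.
  apply/patsetP; split.
    apply: (pg_eq gP (eqport_sym (@ext_tr _ _))).
    by apply: pg_mul gP _ _ _ pP; apply: pg_inv gP _ p0P.
  move=> w wm; rewrite (@ext_tr m.+1 _ w (leqW wm)) -(pmulVp p0 w).
  apply: eqport_mul wm => // v vm; rewrite p0q // -pq; exact/esym/ext_tr.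
move=> [k /patsetP [kP k1] ->]; split.
  by apply/tr_patset => //; apply: pg_mul gP _ _ p0P kP.
apply/eqP; rewrite -[q]extK; apply/tr_eqP => w wm.
rewrite (@ext_tr m.+1 _ w (leqW wm)) -(p0q _ wm) -[RHS]pmulp1.
exact: eqport_mul wm.
Qed.

(* The patterns of size k + m that are restrictions of portraits in G_P and
   themselves restrict to q. *)
Fixpoint grow (k : nat) : pattern m -> {set pattern (k + m)} :=
  match k with
  | 0 => fun q => [set q]
  | k'.+1 => fun q =>
      \bigcup_(p : pattern m.+1)
        if (p \in patset m.+1 P) && (tr m (ext p) == q) then
          setX [set p.1] (setX (grow k' p.2.1) (grow k' p.2.2))
        else set0
  end.

Lemma grow_disjoint k q q' t : t \in grow k q -> t \in grow k q' -> q = q'.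
Proof.
elim: k q q' t => [|k IH] q q' t /=; first by rewrite !inE => /eqP-> /eqP.
case/bigcupP=> -[e [a b]] _; case: ifP => [/andP[_ /eqP <-]|_]; last by rewrite inE.
rewrite !inE => /and3P [/eqP <- ta tb].
case/bigcupP=> -[e' [a' b']] _; case: ifP => [/andP[_ /eqP <-]|_]; last by rewrite inE.
rewrite !inE => /and3P [/eqP <- ta' tb'].
by rewrite (IH _ _ _ ta ta') (IH _ _ _ tb tb').
Qed.

Lemma patset_branch (p : pattern m.+1) : p \in patset m.+1 P ->
  (p.2.1 \in patset m (proj m P)) /\ (p.2.2 \in patset m (proj m P)).
Proof.
move=> /patsetP pP; split; apply/patsetP; [exact: (ssP false pP)|exact: (ssP true pP)].
Qed.

(** One lift of [q] is chosen at the root, then both subtrees grow independently. The exponents add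
    up as 1 + 2 (2^k - 1) = 2^(k+1) - 1. *)
Lemma card_grow k q : q \in patset m (proj m P) ->
  #|grow k q| = ker_card m P ^ (2 ^ k - 1).
Proof.
elim: k q => [|k IH] q qQ; first by rewrite cards1.
rewrite /= -sum1_card partition_disjoint_bigcup /=; last first.
  move=> p p'; apply: contraNT => /pred0Pn [[e [a b]]] /=.
  case: p p' => [u [v w]] [u' [v' w']].
  case: ifP => _; case: ifP => _; rewrite !inE ?andbF //=.
  case/andP=> /and3P [/eqP-> a1 a2] /and3P [/eqP-> b1 b2].
  by rewrite (grow_disjoint a1 b1) (grow_disjoint a2 b2).
rewrite (bigID (fun p => (p \in patset m.+1 P) && (tr m (ext p) == q))) /=.
rewrite [X in _ + X]big1 ?addn0; last first.
  by move=> p /negbTE ->; rewrite big_set0.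
rewrite (eq_bigr (fun=> ker_card m P ^ (2 ^ k.+1 - 2))); last first.
  move=> p pp; rewrite pp sum1_card !cardsX cards1 mul1n.
  case/andP: pp => /patset_branch [p1 p2] _; rewrite !IH // -expnD.
  by congr (_ ^ _); have := expn_gt0 2 k; rewrite expnS; lia.
rewrite sum_nat_const.
rewrite (_ : #|_| = ker_card m P); last first.
  by rewrite -(card_fiber qQ); apply: eq_card => p; rewrite [RHS]inE.
rewrite -expnS; congr (_ ^ _).
by have := expn_gt0 2 k; rewrite expnS; lia.
Qed.

(** These are the portraits of the elements of G_P. *)
Definition constrained (f : port) : Prop := forall w, P (below f w).

Definition lift_port (f : port) : port :=
  epsilon (inhabits pone) (fun p => P p /\ eqport m p f).

Lemma lift_portP f : proj m P f -> P (lift_port f) /\ eqport m (lift_port f) f.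
Proof.
by case=> p pP pf; apply: (epsilon_spec _ (fun p => P p /\ eqport m p f)); exists p.
Qed.

(* A pattern of Q, lifted to P at every vertex in turn, becomes an element of G_P. *)
Fixpoint extend (f : port) (w : seq bool) : bool :=
  if w is b :: v then extend (branch (lift_port f) b) v else lift_port f [::].

Lemma eqport_extend f : proj m P f -> eqport m (extend f) f.
Proof.
suff H n : n <= m -> forall f, proj m P f -> eqport n (extend f) f by apply: H.
elim: n => [//|n IH] nm {}f /lift_portP [lP lf] [|b w] /= wn.
  by rewrite lf //; apply: leq_trans nm.
rewrite (IH (ltnW nm)) //; last exact: ssP.
by rewrite /branch lf //; apply: leq_trans nm.
Qed.

Lemma constrained_extend f : proj m P f -> constrained (extend f).
Proof.
move=> fQ w; elim: w f fQ => [|b w IH] f /lift_portP [lP lf].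
  apply: pg_eq gP _ _ _ (lP) => -[|b w] //= wm.
  by rewrite /below /= eqport_extend //; exact: ssP.
by apply: (IH (branch (lift_port f) b)); apply: ssP.
Qed.

Lemma constrained_branch f b : constrained f -> constrained (branch f b).
Proof. by move=> fC w; apply: (fC (b :: w)). Qed.

Lemma constrained_grow k f : constrained f -> tr (k + m) f \in grow k (tr m f).
Proof.
elim: k f => [|k IH] f fC /=; first by rewrite inE.
apply/bigcupP; exists (tr m.+1 f) => //.
have -> : tr m.+1 f \in patset m.+1 P by apply/tr_patset => //; apply: (fC [::]).
have -> : tr m (ext (tr m.+1 f)) == tr m f.
  apply/eqP/tr_eqP => w wm; exact: (@ext_tr m.+1 _ w (leqW wm)).
by rewrite !inE eqxx !IH //; apply: constrained_branch.
Qed.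

(** Converse of [constrained_grow]: no counted pattern is a dead end. Extensions of the two subtrees
    are glued under the root label of [p], and the glued portrait restricts to [p] itself. *)
Lemma grow_constrained k q t : q \in patset m (proj m P) -> t \in grow k q ->
  exists f, [/\ constrained f, tr (k + m) f = t & tr m f = q].
Proof.
elim: k q t => [|k IH] q t qQ /=.
  rewrite inE => /eqP ->; move/patsetP: qQ => qQ; exists (extend (ext q)).
  suff e : tr m (extend (ext q)) = q by split=> //; apply: constrained_extend.
  by rewrite -[RHS]extK; apply/tr_eqP/eqport_extend.
case/bigcupP=> p _; case: ifP => [/andP [pP /eqP pq]|_]; last by rewrite inE.
case: t => e [a b]; rewrite !inE /= => /and3P [/eqP -> ta tb].
have [p1 p2] := patset_branch pP.
have [f0 [f0C f0t f0p]] := IH _ _ p1 ta.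
have [f1 [f1C f1t f1p]] := IH _ _ p2 tb.
pose g : port := fun w =>
  if w is b :: v then (if b then f1 v else f0 v) else p.1.
have g0 : branch g false = f0 by [].
have g1 : branch g true = f1 by [].
have gp : tr m.+1 g = p by rewrite /= g0 g1 f0p f1p; case: (p) => ? [].
exists g; split.
- move=> [|[] w]; [|exact: (f1C w)|exact: (f0C w)].
  by apply/(tr_patset _ gP); rewrite [tr _ _]gp.
- by rewrite /= g0 g1 f0t f1t.
rewrite -pq -gp; apply/tr_eqP => w wm; apply/esym.
exact: (@ext_tr m.+1 _ w (leqW wm)).
Qed.

Definition patterns_of n (C : port -> Prop) : {set pattern n} :=
  [set t | asb (exists2 f, C f & tr n f = t)].

Lemma card_constrained k :
  #|patterns_of (k + m) constrained| =
  #|patset m (proj m P)| * ker_card m P ^ (2 ^ k - 1).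
Proof.
have -> : patterns_of (k + m) constrained =
    \bigcup_q if q \in patset m (proj m P) then grow k q else set0.
  apply/setP => t; rewrite inE; apply/asbP/bigcupP.
    case=> f fC <-; exists (tr m f) => //.
    suff -> : tr m f \in patset m (proj m P) by apply: constrained_grow.
    by apply/tr_patset; [exact: proj_group | exact: proj_in (fC [::])].
  case=> q _; case: ifP => [qQ|_]; last by rewrite inE.
  by case/(grow_constrained qQ) => f [fC ft _]; exists f.
rewrite -sum1_card partition_disjoint_bigcup /=; last first.
  move=> p p'; apply: contraNT => /pred0Pn [t] /=.
  case: ifP => _; case: ifP => _; rewrite ?inE ?andbF //=.
  by case/andP => a /(grow_disjoint a) ->.
rewrite (bigID (mem (patset m (proj m P)))) /=.
rewrite [X in _ + X]big1 ?addn0; last first.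
  by move=> p /negbTE ->; rewrite big_set0.
rewrite (eq_bigr (fun=> ker_card m P ^ (2 ^ k - 1))) ?sum_nat_const //.
by move=> q qQ; rewrite qQ sum1_card card_grow.
Qed.

End Count.

(** * The kernel at the last level *)

Lemma eqport1 n f g : f =1 g -> eqport n f g.
Proof. by move=> fg w _. Qed.

Lemma eqportW m n f g : m <= n -> eqport n f g -> eqport m f g.
Proof. by move=> mn fg w wm; apply: fg; apply: leq_trans mn. Qed.

Definition graft (i : bool) (g : port) : port :=
  fun w => if w is b :: v then (b == i) && g v else false.

Definition vertex (u : seq bool) : port := fun w => w == u.

Definition rootp (e : bool) : port := fun w => (w == [::]) && e.

Definition level_pattern n := patset n.+1 (fun f => eqport n f pone).

Lemma level_patternP n (t : pattern n.+1) :
  reflect (eqport n (ext t) pone) (t \in level_pattern n).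
Proof. exact: patsetP. Qed.

Lemma card_level_pattern n : #|level_pattern n| = 2 ^ 2 ^ n.
Proof.
elim: n => [|n IH].
  rewrite (_ : level_pattern 0 = setT) ?cardsT.
    by rewrite !card_prod card_bool card_unit.
  by apply/setP => t; rewrite [RHS]inE; apply/level_patternP.
rewrite (_ : level_pattern n.+1 =
    setX [set false] (setX (level_pattern n) (level_pattern n))).
  by rewrite !cardsX cards1 mul1n IH -expnD addnn expnS mul2n.
apply/setP => -[e [a b]]; rewrite !in_setX in_set1 /=.
apply/(@level_patternP n.+1)/and3P
  => [H|[/eqP -> /level_patternP Ha /level_patternP Hb] [|[] w] //= wn].
- split; first exact/eqP/(H [::]).
    by apply/level_patternP => w wn; apply: (H (false :: w)).
  by apply/level_patternP => w wn; apply: (H (true :: w)).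
- exact: Hb.
- exact: Ha.
Qed.

Section Kernel.
Variables (m : nat) (P : port -> Prop).
Hypothesis gP : pattern_group m.+1 P.
Let K := kernel m P.

Lemma ker_eq f g : eqport m.+1 f g -> K f -> K g.
Proof.
move=> fg [fP f1]; split; first exact: pg_eq fg fP.
by apply: eqport_trans f1; apply/eqport_sym/(eqportW _ fg).
Qed.

(** Such a [g] fixes all words of length at most [m], so composition merely adds labels. This turns
    the kernel into a vector space over the field with two elements. *)
Lemma eqport_pmul_padd f g :
  eqport m g pone -> eqport m.+1 (pmul f g) (padd f g).
Proof. by move=> g1 w wm; rewrite /pmul (eqport_act g1 wm) act_one. Qed.

Lemma ker_padd f g : K f -> K g -> K (padd f g).
Proof.
move=> [fP f1] [gP' g1]; split.
  exact: (pg_eq gP (eqport_pmul_padd f g1) (pg_mul gP fP gP')).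
by move=> w wm; rewrite /padd f1 // g1.
Qed.

Lemma ker_one : K pone.
Proof. by split=> //; apply: pg_one gP. Qed.

Section Cosets.
Variables (I : finType) (r : I -> port).
Hypothesis r1 : forall i, eqport m (r i) pone.

Let h (x : I * pattern m.+1) : pattern m.+1 := tr m.+1 (padd (ext x.2) (r x.1)).
Let D := setX [set: I] (patset m.+1 K).

Let card_D : #|D| = #|I| * ker_card m P.
Proof. by rewrite cardsX cardsT. Qed.

Let h_level : h @: D \subset level_pattern m.
Proof.
apply/subsetP => t /imsetP [[i k]]; rewrite in_setX /=.
case/andP => _ /(@patsetP m.+1) [_ k1] ->.
apply/level_patternP => w wm; rewrite (@ext_tr m.+1 _ w (leqW wm)) /padd k1 //.
by rewrite r1.
Qed.

Let h_eq i j k l : h (i, k) = h (j, l) ->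
  eqport m.+1 (padd (ext k) (ext l)) (padd (r i) (r j)).
Proof.
move/tr_eqP => e w wm.
have : padd (ext k) (r i) w = padd (ext l) (r j) w := e w wm.
rewrite /padd.
by case: (ext k w) (ext l w) (r i w) (r j w) => [] [] [] [].
Qed.

(** If the [r i] are distinct modulo K, then (i, k) -> k + r i is injective into the 2^(2^m)
    last-level patterns; when the cardinalities match it is also onto. *)
Lemma cosets_cover :
  (forall i j, K (padd (r i) (r j)) -> i = j) ->
  #|I| * ker_card m P <= 2 ^ 2 ^ m /\
  (2 ^ 2 ^ m <= #|I| * ker_card m P ->
   forall f, eqport m f pone -> exists i, K (padd f (r i))).
Proof.
move=> rinj.
have hinj : {in D &, injective h}.
  move=> [i k] [j l]; rewrite !in_setX /=.
  case/andP => _ /(@patsetP m.+1) kK /andP[_ /(@patsetP m.+1) lK] hh.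
  have ij : i = j by apply: rinj; apply: (ker_eq (h_eq hh)); apply: ker_padd.
  suff -> : k = l by rewrite ij.
  rewrite -[k]extK -[RHS]extK; apply/tr_eqP => w wm.
  by have := h_eq hh wm; rewrite ij /padd addbb; do 2!case: (ext _ _).
rewrite -card_level_pattern -card_D -(card_in_imset hinj).
split=> [|le f f1]; first exact: subset_leq_card.
have hD : h @: D = level_pattern m by apply/eqP; rewrite eqEcard h_level.
have : tr m.+1 f \in h @: D.
  rewrite hD; apply/level_patternP => w wm.
  by rewrite (@ext_tr m.+1 _ w (leqW wm)) f1.
case/imsetP => -[i k]; rewrite in_setX => /andP[_ kD] e.
have kK : K (ext k) by apply/patsetP.
have fk : eqport m.+1 f (padd (ext k) (r i)) by apply/tr_eqP.
exists i; apply: ker_eq kK => w wm.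
by rewrite /padd fk // /padd addbK.
Qed.

(** Dual of [cosets_cover]: the same map is now onto, and equal cardinalities make it injective. *)
Lemma cosets_inj :
  (forall f, eqport m f pone -> exists i, K (padd f (r i))) ->
  2 ^ 2 ^ m <= #|I| * ker_card m P /\
  (#|I| * ker_card m P <= 2 ^ 2 ^ m ->
   forall i j, K (padd (r i) (r j)) -> i = j).
Proof.
move=> cov.
have hD : h @: D = level_pattern m.
  apply/eqP; rewrite eqEsubset h_level; apply/subsetP => t /level_patternP /cov [i tK].
  apply/imsetP; exists (i, tr m.+1 (padd (ext t) (r i))).
    rewrite in_setX inE; apply/(@patsetP m.+1 K).
    by apply: ker_eq tK; apply/eqport_sym/ext_tr.
  rewrite -[LHS]extK; apply/tr_eqP => w wm.
  by rewrite /padd (@ext_tr m.+1 _ w wm) /padd addbK.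
rewrite -card_level_pattern -card_D -hD leq_imset_card; split=> // le i j rK.
have /imset_injP hinj : #|h @: D| == #|D| by rewrite eqn_leq leq_imset_card.
suff : (i, tr m.+1 pone) = (j, tr m.+1 (padd (r i) (r j))) by case.
apply: hinj.
- rewrite in_setX inE; apply/(@patsetP m.+1 K).
  by apply: ker_eq ker_one; apply/eqport_sym/ext_tr.
- rewrite in_setX inE; apply/(@patsetP m.+1 K).
  by apply: ker_eq rK; apply/eqport_sym/ext_tr.
apply/tr_eqP => w wm.
by rewrite /padd !(@ext_tr m.+1 _ w wm) /padd addbK.
Qed.

End Cosets.
End Kernel.

(** * Full projection, or a smaller pattern size *)

Definition join (a b : port) : port :=
  fun w => if w is c :: v then (if c then b v else a v) else false.

Lemma eqport_branch n f g i : eqport n.+1 f g -> eqport n (branch f i) (branch g i).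
Proof. by move=> fg w wn; apply: fg. Qed.

Lemma proj_self_similar n P : self_similar n.+1 P -> self_similar n (proj n.+1 P).
Proof.
move=> ssP f i [p pP pf]; exists (branch p i); first exact: ssP.
exact: eqport_branch.
Qed.

(** A last-level pattern of size [n] placed below the letter 0 is a last-level pattern of [Q], and
    self-similarity brings it back into the projection. By induction the projection is full, and any
    [f] then differs from some element of [Q] by a last-level pattern. *)
Lemma full_of_kernel n Q : pattern_group n.+1 Q -> self_similar n Q ->
  (forall f, eqport n f pone -> Q f) -> forall f, Q f.
Proof.
elim: n Q => [|n IH] Q gQ ssQ kQ f; first exact: kQ.
have gR := proj_group gQ; have ssR := proj_self_similar ssQ.
have kR g : eqport n g pone -> proj n.+1 Q g.
  move=> g1; apply: (ssQ (join g pone) false).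
  by apply: kQ => -[|[] w] //= wn; apply: g1.
have [q qQ qf] := IH _ gR ssR kR f.
have : Q (pmul q (pmul (pinv q) f)).
  apply: (pg_mul gQ qQ); apply: kQ => w wn; rewrite -(pmulVp q w).
  by apply: eqport_mul wn => // v vn; rewrite qf.
exact/(pg_eq gQ)/eqport1/pmulVKp.
Qed.

(* The kernel embeds into the square of the last-level kernel of the projection;
   when the latter is not everything, it has index at least 2 and the cardinality
   hypothesis turns the embedding into an equality. *)
Lemma kernel_dichotomy m P : pattern_group m.+2 P -> self_similar m.+1 P ->
  ker_card m.+1 P = 2 ^ (2 ^ m.+1 - 2) ->
  (forall f, eqport m f pone -> proj m.+1 P f) \/
  (forall a b, kernel m (proj m.+1 P) a -> kernel m (proj m.+1 P) b -> P (join a b)).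
Proof.
move=> gP ssP kP; set Q := proj m.+1 P.
have gQ : pattern_group m.+1 Q := proj_group gP.
case: (excluded_middle_informative (forall f, eqport m f pone -> Q f)); first by left.
move=> nQ; right.
have [x xQ x1] : exists2 x, ~ Q x & eqport m x pone.
  apply: NNPP => H; apply: nQ => f f1; apply: NNPP => fQ; apply: H; by exists f.
pose r (b : bool) : port := if b then x else pone.
have xK f : f =1 x -> ~ kernel m Q f.
  by move=> fx [fQ _]; apply: xQ; exact: (pg_eq gQ (eqport1 fx) fQ).
have [||le _] := @cosets_cover m Q gQ bool r.
- by case.
- by move=> [] [] // /xK [] // w; rewrite /r /padd ?addbF.
have sub : patset m.+2 (kernel m.+1 P) \subset
    setX [set false] (setX (patset m.+1 (kernel m Q)) (patset m.+1 (kernel m Q))).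
  apply/subsetP => -[e [a b]] /patsetP [kP' k1]; rewrite !in_setX in_set1.
  apply/and3P; split.
  - exact/eqP/(k1 [::]).
  - apply/(@patsetP m.+1 (kernel m Q)); split.
      exact: (ssP _ false) kP'.
    exact: (eqport_branch false k1).
  - apply/(@patsetP m.+1 (kernel m Q)); split.
      exact: (ssP _ true) kP'.
    exact: (eqport_branch true k1).
have := sub; rewrite subEproper => /orP [/eqP E|]; last first.
  (* Index at least 2 bounds the kernel of [Q] by 2^(2^m - 1). The square of this bound is
     2^(2^(m+1) - 2), the order of the kernel of [P], so the inclusion cannot be proper. *)
  move/proper_card; rewrite !cardsX cards1 mul1n -!/(ker_card _ _) kP.
  rewrite card_bool in le; move: le; have := expn_gt0 2 m; rewrite expnS /=.
  case: (2 ^ m) => // s _; rewrite expnS leq_pmul2l // => le.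
  rewrite ltnNge => /negP []; apply: leq_trans (leq_mul le le) _.
  by rewrite -expnD leq_exp2l //; lia.
move=> a b aK bK.
suff : tr m.+2 (join a b) \in patset m.+2 (kernel m.+1 P).
  by case/patsetP => H _; apply: (pg_eq gP _ H); apply: ext_tr.
rewrite E !in_setX in_set1 eqxx /=.
by apply/andP; split; apply/(@patsetP m.+1 (kernel m Q));
  [apply: (ker_eq gQ _ aK) | apply: (ker_eq gQ _ bK)];
  apply/eqport_sym/ext_tr.
Qed.

(** At each vertex, dividing by a [p] in [P] with the same restriction leaves a last-level pattern
    [k]. Its branches lie in the kernel of the projection, because [f] is constrained at both
    children of the vertex, so [k] is their join. *)
Lemma constrained_of_join m P : pattern_group m.+2 P -> self_similar m.+1 P ->
  (forall a b, kernel m (proj m.+1 P) a -> kernel m (proj m.+1 P) b -> P (join a b)) ->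
  forall f, constrained (proj m.+1 P) f -> constrained P f.
Proof.
move=> gP ssP PJ f fC w; have := fC w; move=> [p pP pf].
have gQ := proj_group gP.
pose k := pmul (pinv p) (below f w).
suff kP : P k.
  exact: (pg_eq gP (eqport1 (pmulVKp p _)) (pg_mul gP pP kP)).
have k1 : eqport m.+1 k pone.
  move=> v vm; rewrite -(pmulVp p v).
  by apply: eqport_mul vm => // x xm; rewrite pf.
have kb b : kernel m (proj m.+1 P) (branch k b).
  split; last exact: (@eqport_branch m k pone b k1).
  rewrite -[branch k b]/(pmul (branch (pinv p) (b (+) below f w [::]))
                              (branch (below f w) b)).
  apply: (pg_mul gQ); first exact/ssP/(pg_inv gP).
  apply: (pg_eq gQ _ (fC (rcons w b))); apply: eqport1 => v.
  by rewrite /below /branch cat_rcons.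
apply: (pg_eq gP _ (PJ _ _ (kb false) (kb true))); apply: eqport1.
by move=> [|[] v] //=; rewrite k1.
Qed.

(** * Level parities and the invariant subspace of index 4 *)

Fixpoint parity (n : nat) (f : port) : bool :=
  if n is k.+1 then parity k (branch f false) (+) parity k (branch f true)
  else f [::].

Lemma parity_eq n f g : eqport n.+1 f g -> parity n f = parity n g.
Proof.
elim: n f g => [|n IH] f g fg /=; first exact: fg.
by rewrite !(IH _ _ (eqport_branch _ fg)).
Qed.

Lemma parity_padd n f g : parity n (padd f g) = parity n f (+) parity n g.
Proof.
elim: n f g => //= n IH f g.
by rewrite !(IH (branch f _) (branch g _)) !addbA; congr (_ (+) _); rewrite addbAC.
Qed.

(** [parity n] sums the labels over the words of length [n], and [g] only permutes these words. *)
Lemma parity_pmul n f g : parity n (pmul f g) = parity n f (+) parity n g.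
Proof.
elim: n f g => [|n IH] f g; first by [].
rewrite /= !(IH (branch f _) (branch g _)) /=.
by case: (g [::]) => /=; move: (parity _ _) (parity _ _) (parity _ _) (parity _ _)
  => [] [] [] [].
Qed.

Definition scale (b : bool) (f : port) : port := if b then f else pone.

Lemma graft_padd i f g : graft i (padd f g) =1 padd (graft i f) (graft i g).
Proof. by case=> [|b w] //=; rewrite /padd /=; case: (b == i). Qed.

Lemma graft_vertex i u : graft i (vertex u) =1 vertex (i :: u).
Proof. by case. Qed.

Lemma graft_scale i b u : graft i (scale b (vertex u)) =1 scale b (vertex (i :: u)).
Proof.
move=> w; case: b; rewrite /= ?graft_vertex //.
by case: w => //= ? ?; rewrite andbF.
Qed.

Lemma eqport_graft n i f g : eqport n f g -> eqport n.+1 (graft i f) (graft i g).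
Proof. by move=> fg [|b w] //= wn; rewrite fg. Qed.

Lemma act_graft i g w : act (graft i g) (i :: w) = i :: act g w.
Proof.
rewrite /= addbF (_ : branch _ i = g) //.
by apply: functional_extensionality => v; rewrite /branch /= eqxx.
Qed.

Lemma act_graftN i g w : act (graft i g) (~~ i :: w) = ~~ i :: w.
Proof.
rewrite /= addbF (_ : branch _ _ = pone) ?act_one //.
by apply: functional_extensionality => v; rewrite /branch /=; case: i.
Qed.

Lemma graft_split n f : eqport n.+1 f pone ->
  f =1 padd (graft false (branch f false)) (graft true (branch f true)).
Proof.
move=> f1 [|[] w]; rewrite /padd //=; first by rewrite f1.
by rewrite addbF.
Qed.

(** Modulo K all vertices of the level coincide, so only the number of nonzero labels modulo 2
    survives. The predicate [K] is arbitrary so that the lemma also applies to one half of the tree,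
    through [fun h => K (graft i h)]. *)
Lemma parity_span n (K : port -> Prop) :
  (forall f g, eqport n.+1 f g -> K f -> K g) ->
  (forall f g, K f -> K g -> K (padd f g)) ->
  (forall u v, size u = n -> size v = n -> K (padd (vertex u) (vertex v))) ->
  forall f u, eqport n f pone -> size u = n ->
    K (padd f (scale (parity n f) (vertex u))).
Proof.
elim: n K => [|n IH] K Keq Kadd Kvv f u f1 un.
  (* Membership of zero is obtained as a vertex added to itself, here and in [Kv] below. *)
  have u0 := size0nil un; apply: Keq (Kvv [::] [::] erefl erefl) => -[|//] _.
  by rewrite /padd u0 /=; case: (f [::]).
have H i : K (graft i (padd (branch f i)
    (scale (parity n (branch f i)) (vertex (nseq n false))))).
  apply: (IH (fun h => K (graft i h))); rewrite ?size_nseq //.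
  - by move=> g h gh; apply: Keq; apply: eqport_graft.
  - move=> g h gK hK; apply: Keq (Kadd _ _ gK hK); apply: eqport1 => w.
    by rewrite graft_padd.
  - move=> v w vn wn; apply: Keq (Kvv (i :: v) (i :: w) _ _); rewrite /= ?vn ?wn //.
    by apply: eqport1 => x; rewrite graft_padd /padd !graft_vertex.
  - exact: eqport_branch f1.
have Kv i b : K (scale b (padd (vertex (i :: nseq n false)) (vertex u))).
  case: b; first by apply: Kvv => //=; rewrite size_nseq.
  by apply: Keq (Kvv u u un un); apply: eqport1 => w; rewrite /padd addbb.
have := Kadd _ _ (Kadd _ _ (H false) (H true))
  (Kadd _ _ (Kv false (parity n (branch f false)))
            (Kv true (parity n (branch f true)))).
apply: Keq; apply: eqport1 => w.
rewrite {1}/padd {1}[padd (graft _ _) _ w]/padd !graft_padd [padd f _ w]/padd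
  (graft_split f1) /= /padd -!/(branch _ _).
rewrite !graft_scale.
case: (parity n (branch f false)) (parity n (branch f true)) => [] [] /=;
  rewrite ?addbF ?/padd ?/pone;
  by case: (graft false (branch f false) w) (graft true (branch f true) w)
    (vertex (false :: nseq n false) w) (vertex (true :: nseq n false) w) (vertex u w)
    => [] [] [] [] [].
Qed.

(** Labels depend on the length only: this automorphism adds u + v letterwise, hence exchanges [u]
    and [v] when they have equal length. *)
Definition translation (u v : seq bool) : port :=
  fun w => nth false u (size w) (+) nth false v (size w).

Lemma act_translation u v : size u = size v -> act (translation u v) u = v.
Proof.
elim: u v => [|a u IH] [|b v] //= [uv].
rewrite {1}/translation /= addbA addbb addFb.
by rewrite -[branch _ _]/(translation u v) IH.
Qed.

Lemma translationC u v : translation u v = translation v u.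
Proof. by apply: functional_extensionality => w; rewrite /translation addbC. Qed.

Lemma vertex_act g u w : vertex (act g u) (act g w) = vertex u w.
Proof. by rewrite /vertex (inj_eq (@act_inj g)). Qed.

Section KernelShape.
Variables (m : nat) (P : port -> Prop).
Hypothesis gP : pattern_group m.+2 P.
Hypothesis fullP : forall f, proj m.+1 P f.
Hypothesis cardP : ker_card m.+1 P = 2 ^ (2 ^ m.+1 - 2).
Let K := kernel m.+1 P.
Let Kadd := @ker_padd m.+1 P gP.
Let Keq := @ker_eq m.+1 P gP.

Let cardP4 : 4 * ker_card m.+1 P = 2 ^ 2 ^ m.+1.
Proof.
rewrite cardP -[4]/(2 ^ 2) -expnD; congr (_ ^ _).
by have := expn_gt0 2 m; rewrite expnS; lia.
Qed.

(** Lift [g] to [p] in [P]. As [k] lives on the last level, conjugating it by [p] just permutes its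
    labels along [g]. *)
Lemma ker_act g k : K k -> K (fun w => k (act g w)).
Proof.
move=> [kP k1]; have [p pP pg] := fullP g.
have c1 : eqport m.+1 (fun w => k (act g w)) pone.
  by move=> w wm; rewrite k1 // size_act.
split=> //; apply: (pg_eq gP _ (pg_mul gP (pg_inv gP pP) (pg_mul gP kP pP))).
apply: (@pmul_cancel _ p) => w wm; rewrite pmulVKp.
rewrite (eqport_pmul_padd p c1 wm) /padd [RHS]addbC /pmul; congr (k _ (+) _).
exact: eqport_act pg wm.
Qed.

Lemma eqport_vertex u : size u = m.+1 -> eqport m.+1 (vertex u) pone.
Proof.
by move=> um w wm; apply/negbTE/eqP => wu; move: wm; rewrite wu um ltnn.
Qed.

Lemma eqport_padd n f g :
  eqport n f pone -> eqport n g pone -> eqport n (padd f g) pone.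
Proof. by move=> f1 g1 w wn; rewrite /padd f1 ?g1. Qed.

Lemma eqport_scale n b f : eqport n f pone -> eqport n (scale b f) pone.
Proof. by case: b. Qed.

(** Translations are transitive on the level, so one vertex in K would put all of them there; K
    would then have index 1 instead of 4. *)
Lemma vertex_notin_ker u : size u = m.+1 -> ~ K (vertex u).
Proof.
move=> um uK.
have vK v : size v = m.+1 -> K (vertex v).
  move=> vm; apply: Keq (ker_act (translation v u) uK); apply: eqport1 => w.
  by rewrite -{1}(act_translation (etrans vm (esym um))) vertex_act.
have [||] := @cosets_inj m.+1 P gP unit (fun=> pone).
- by [].
- move=> f f1; exists tt.
  apply: Keq (Kadd (parity_span Keq Kadd _ f1 um)
                   (_ : K (scale (parity m.+1 f) (vertex u)))).
  + by apply: eqport1 => w; rewrite /padd addbK addbF.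
  + by move=> v w vm wm; apply: Kadd; apply: vK.
  + by case: (parity _ _) => //; apply: ker_one.
rewrite card_unit -cardP4 => le _; move: le.
by have := expn_gt0 2 (2 ^ m.+1 - 2); rewrite cardP; lia.
Qed.

(* Write a, b for the classes of two vertices of one half modulo the kernel, of
   index 4, and suppose a <> b.  The classes are then 0, a, b, a + b.  An element
   swapping these two vertices and fixing the other half shows that every vertex
   of the other half has class a + b; exchanging the halves gives a = b. *)
Lemma vertex_pair_ker i u v : size u = m -> size v = m ->
  K (padd (vertex (i :: u)) (vertex (i :: v))).
Proof.
move=> um vm; apply: NNPP => nK.
pose A := vertex (i :: u); pose B := vertex (i :: v).
pose r (x : bool * bool) := padd (scale x.1 A) (scale x.2 B).
have rr x y : padd (r x) (r y) =1 r (x.1 (+) y.1, x.2 (+) y.2).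
  move=> w; case: x y => [[] []] [[] []]; rewrite /r /padd /= /pone;
  by case: (A w) (B w) => [] [].
have A1 : eqport m.+1 A pone by apply: eqport_vertex; rewrite /= um.
have B1 : eqport m.+1 B pone by apply: eqport_vertex; rewrite /= vm.
have r0 s t : K (r (s, t)) -> s = false /\ t = false.
  case: s t => [] [] // rK; exfalso.
  - apply: (@vertex_notin_ker (i :: u)); first by rewrite /= um.
    by apply: Keq rK; apply: eqport1 => w; rewrite /r /padd addbF.
  - apply: (@vertex_notin_ker (i :: v)); first by rewrite /= vm.
    by apply: Keq rK; apply: eqport1 => w; rewrite /r /padd.
have [||_ cov] := @cosets_cover m.+1 P gP _ r.
- by move=> x; apply: eqport_padd; apply: eqport_scale.
- move=> [s t] [s' t'] /(Keq (eqport1 (rr _ _))) /r0 /=.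
  by case: s t s' t' => [] [] [] [] [].
have opp w : size w = m -> K (padd (vertex (~~ i :: w)) (r (true, true))).
  move=> wm; have C1 : eqport m.+1 (vertex (~~ i :: w)) pone.
    by apply: eqport_vertex; rewrite /= wm.
  have := cov _ _ C1; rewrite card_prod card_bool cardP4 leqnn => /(_ isT) [[s t] Kst].
  pose g := graft i (translation u v).
  have gu : act g (i :: u) = i :: v by rewrite act_graft act_translation // um.
  have gv : act g (i :: v) = i :: u.
    by rewrite act_graft translationC act_translation // vm.
  have gw : act g (~~ i :: w) = ~~ i :: w by rewrite act_graftN.
  have Kts : K (padd (vertex (~~ i :: w)) (r (t, s))).
    apply: Keq (ker_act g Kst); apply: eqport1 => x.
    rewrite /padd -{1}gw vertex_act; congr (_ (+) _); rewrite /r /padd /= addbC.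
    have AB : B (act g x) = A x by rewrite /A /B -gu vertex_act.
    have BA : A (act g x) = B x by rewrite /A /B -gv vertex_act.
    by congr (_ (+) _); [case: (t) | case: (s)].
  (* Adding the two memberships cancels the vertex and forces [s = t]; both being false would put
     that vertex into K. *)
  have : K (r (s (+) t, t (+) s)).
    apply: Keq (Kadd Kst Kts); apply: eqport1 => x.
    by rewrite -(rr (s, t) (t, s)) /padd addbACA addbb addFb.
  case/r0 => st _; have {}st : s = t by move: st; case: (s) (t) => [] [].
  move: Kst; rewrite st; case: (t) => // CK.
  exfalso; apply: (@vertex_notin_ker (~~ i :: w)); first by rewrite /= wm.
  by apply: Keq CK; apply: eqport1 => x; rewrite /r /padd /= !addbF.
have KC : K (padd (vertex (~~ i :: u)) (vertex (~~ i :: v))).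
  apply: Keq (Kadd (opp u um) (opp v vm)); apply: eqport1 => x.
  by rewrite /padd addbACA addbb addbF.
apply: nK; apply: Keq (ker_act (vertex [::]) KC); apply: eqport1 => x.
have rot w : ~~ i :: w = act (vertex [::]) (i :: w).
  by rewrite /= addbT -[branch _ _]/pone act_one.
by rewrite /padd !rot !vertex_act.
Qed.

(** By [parity_span] in each half, every last-level pattern is congruent to the combination of one
    fixed vertex per half given by its two parities. These four combinations cover an index 4
    quotient, so they are distinct modulo K, and K is the class with both parities zero. *)
Lemma kernelP f : eqport m.+1 f pone ->
  P f <-> forall i, parity m (branch f i) = false.
Proof.
move=> f1.
pose r (x : bool * bool) :=
  padd (scale x.1 (vertex (false :: nseq m false)))
       (scale x.2 (vertex (true :: nseq m false))).
have repr g : eqport m.+1 g pone ->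
    K (padd g (r (parity m (branch g false), parity m (branch g true)))).
  move=> g1.
  have H i : K (graft i (padd (branch g i)
      (scale (parity m (branch g i)) (vertex (nseq m false))))).
    apply: (@parity_span m (fun h => K (graft i h))); rewrite ?size_nseq //.
    - by move=> h h' hh; apply: Keq; apply: eqport_graft.
    - move=> h h' hK hK'; apply: Keq (Kadd hK hK'); apply: eqport1 => w.
      by rewrite graft_padd.
    - move=> v w vn wn; apply: Keq (vertex_pair_ker i vn wn).
      by apply: eqport1 => x; rewrite graft_padd /padd !graft_vertex.
    - exact: eqport_branch g1.
  apply: Keq (Kadd (H false) (H true)); apply: eqport1 => w.
  rewrite {1}/padd !graft_padd /padd !graft_scale /r /padd (graft_split g1 w).
  by rewrite /padd addbACA.
have [||_ inj] := @cosets_inj m.+1 P gP _ r.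
- by move=> x; apply: eqport_padd; apply: eqport_scale; apply: eqport_vertex;
    rewrite /= size_nseq.
- by move=> g g1; eexists; apply: repr.
move: inj; rewrite card_prod card_bool cardP4 leqnn => /(_ isT) inj.
have r00 w : r (false, false) w = false by [].
split=> [fP|f0].
  have fK : K f by [].
  have [] : (parity m (branch f false), parity m (branch f true)) = (false, false).
    apply: inj; apply: Keq (Kadd (repr _ f1) fK); apply: eqport1 => w.
    by rewrite /padd r00 addbAC addbb addbF.
  by move=> p0 p1 [].
suff [] : K f by [].
apply: Keq (repr _ f1); apply: eqport1 => w.
by rewrite !f0 /padd r00 addbF.
Qed.

End KernelShape.

(** * Cocycles *)

Lemma pmul_decomp f :
  f =1 pmul (rootp (f [::]))
    (pmul (graft false (branch f false)) (graft true (branch f true))).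
Proof.
case=> [|b w]; first by rewrite /pmul /rootp /= addbF.
rewrite {1}/pmul /pmul [rootp _ _]/= addFb.
by case: b; rewrite ?act_graft ?(act_graftN true) /= ?addbF.
Qed.

Lemma graft_pmul i f g : graft i (pmul f g) =1 pmul (graft i f) (graft i g).
Proof.
case=> [|b w] //; rewrite {2}/pmul; case: (eqVneq b i) => [->|bi].
  by rewrite act_graft /= eqxx.
have -> : b = ~~ i by case: b i bi => [] [].
by rewrite act_graftN /=; case: i {bi}.
Qed.

Lemma rootp_addb a b : rootp (a (+) b) =1 pmul (rootp a) (rootp b).
Proof. by case=> [|c w]; case: a b => [] []. Qed.

(* Each element factors as a product of a rooted one and one element supported below
   each letter; restrict the homomorphism to these factors and induct. *)
Lemma hom_additive n (chi : port -> bool) :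
  (forall f g, eqport n f g -> chi f = chi g) ->
  (forall f g, chi (pmul f g) = chi f (+) chi g) ->
  forall f g, chi (padd f g) = chi f (+) chi g.
Proof.
elim: n chi => [|n IH] chi chi_eq chiM f g.
  by rewrite -chiM; apply: chi_eq.
have chi1 h h' : h =1 h' -> chi h = chi h' by move=> hh; apply: chi_eq; apply: eqport1.
have gr i h h' : chi (graft i (padd h h')) = chi (graft i h) (+) chi (graft i h').
  apply: (IH (fun h => chi (graft i h))) => {}h {}h' => [hh|].
    exact/chi_eq/eqport_graft.
  by rewrite (chi1 _ _ (graft_pmul _ _ _)) chiM.
have dec h : chi h = chi (rootp (h [::])) (+)
    (chi (graft false (branch h false)) (+) chi (graft true (branch h true))).
  by rewrite {1}(chi1 _ _ (pmul_decomp h)) !chiM.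
rewrite (dec (padd f g)) (dec f) (dec g) (chi1 _ _ (rootp_addb _ _)) chiM.
rewrite (gr false (branch f false)) (gr true (branch f true)).
by rewrite [X in _ (+) X = _]addbACA addbACA.
Qed.

(** Grafted elements have trivial root label, so on them the cocycle rule keeps the index [i] and
    [hom_additive] applies. Only the rooted factor has to be treated apart. *)
Lemma cocycle_additive n (phi : bool -> port -> bool) :
  (forall i f g, eqport n.+1 f g -> phi i f = phi i g) ->
  (forall i f g, phi i (pmul f g) = phi (i (+) g [::]) f (+) phi i g) ->
  forall i f g, phi i (padd f g) = phi i f (+) phi i g.
Proof.
move=> phi_eq phiM i f g.
have phi1 h h' : h =1 h' -> phi i h = phi i h' by move=> hh; apply/phi_eq/eqport1.
have one0 : phi i pone = false.
  have := phiM i pone pone; rewrite (phi1 _ _ (pmul1p pone)) addbF.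
  by case: (phi i pone).
have gr j h h' : phi i (graft j (padd h h')) = phi i (graft j h) (+) phi i (graft j h').
  apply: (@hom_additive n (fun h => phi i (graft j h))) => {}h {}h' => [hh|].
    exact/phi_eq/eqport_graft.
  by rewrite (phi1 _ _ (graft_pmul _ _ _)) phiM addbF.
have dec h : phi i h = phi i (rootp (h [::])) (+)
    (phi i (graft false (branch h false)) (+) phi i (graft true (branch h true))).
  by rewrite {1}(phi1 _ _ (pmul_decomp h)) !phiM !addbF.
(* The cocycle rule would exchange the indices here; instead the few values of [a] and [b] are
   checked, using that the identity has value zero. *)
have root a b : phi i (rootp (a (+) b)) = phi i (rootp a) (+) phi i (rootp b).
  have r0 : phi i (rootp false) = false.
    by rewrite (phi1 _ pone) // => w; rewrite /rootp andbF.
  by case: a b => [] []; rewrite /= ?r0 ?addbb ?addbF.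
rewrite (dec (padd f g)) (dec f) (dec g) root.
rewrite (gr false (branch f false)) (gr true (branch f true)).
by rewrite [X in _ (+) X = _]addbACA addbACA.
Qed.

(** By [kernelP], [f] is in [P] exactly when each [S i f] equals [S i (l f)] for the chosen lift
    [l f] in [P] of the restriction of [f]. The function [S i (l f)] is the cocycle phi_i, so both
    sides are additive. *)
Lemma pattern_padd m P : pattern_group m.+2 P ->
  (forall f, proj m.+1 P f) -> ker_card m.+1 P = 2 ^ (2 ^ m.+1 - 2) ->
  forall f g, P f -> P g -> P (padd f g).
Proof.
move=> gP fullP cardP.
pose S i (f : port) := parity m (branch f i).
pose l f := lift_port m.+1 P f.
have lP f : P (l f) /\ eqport m.+1 (l f) f by apply: lift_portP; apply: fullP.
have S_mul i f g : S i (pmul f g) = S (i (+) g [::]) f (+) S i g.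
  exact: (parity_pmul m (branch f (i (+) g [::])) (branch g i)).
have k1 f : eqport m.+1 (pmul (pinv (l f)) f) pone.
  move=> w wm; rewrite -(pmulVp (l f) w); apply: eqport_mul wm => // v vm.
  by rewrite (proj2 (lP f)).
have S_diff f i : S i f = S i (l f) (+) S i (pmul (pinv (l f)) f).
  have e : eqport m.+2 f (pmul (l f) (pmul (pinv (l f)) f)).
    by apply: eqport1 => w; rewrite pmulVKp.
  rewrite {1}/S (parity_eq (eqport_branch i e)) -/(S i _) S_mul.
  by rewrite (k1 f [::]) // addbF.
have memP f : P f <-> forall i, S i f = S i (l f).
  split=> [fP i|fS].
    have kP : P (pmul (pinv (l f)) f) := pg_mul gP (pg_inv gP (proj1 (lP f))) fP.
    by rewrite S_diff [X in _ (+) X](proj1 (kernelP gP fullP cardP (k1 f)) kP) addbF.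
  have kP : P (pmul (pinv (l f)) f).
    apply/(kernelP gP fullP cardP (k1 f)) => i; apply: (@addbI (S i (l f))).
    by rewrite -/(S i _) -S_diff fS addbF.
  exact: (pg_eq gP (eqport1 (pmulVKp (l f) f)) (pg_mul gP (proj1 (lP f)) kP)).
have uniq p f i : P p -> eqport m.+1 p f -> S i p = S i (l f).
  move=> pP pf; rewrite (proj1 (memP p) pP) /l /lift_port.
  (* [p] and [f] have the same restriction, so the predicates under [epsilon] coincide and both get
     the same lift. *)
  congr (S i (epsilon _ _)); apply: functional_extensionality => q.
  apply: propositional_extensionality; split=> -[qP e]; split=> //.
    exact: eqport_trans pf.
  exact: eqport_trans (eqport_sym pf).
have phiD : forall i f g, S i (l (padd f g)) = S i (l f) (+) S i (l g).
  apply: (@cocycle_additive m (fun i f => S i (l f))) => i f g.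
    move=> fg; apply: uniq; first exact: (proj1 (lP f)).
    exact: eqport_trans (proj2 (lP f)) fg.
  have [fP ff] := lP f; have [gP' gg] := lP g.
  rewrite -(uniq (pmul (l f) (l g)) (pmul f g)) ?S_mul ?gg //.
    exact: (pg_mul gP).
  exact: eqport_mul.
move=> f g /memP fS /memP gS; apply/memP => i.
by rewrite phiD -fS -gS; apply: (parity_padd m (branch f i) (branch g i)).
Qed.

(** * Transfer to the given group and dimension *)

Definition ports d (P : {set {perm W d}}) : port -> Prop :=
  fun f => exists2 p, p \in P & forall u, size u <= d -> actf p u = act f u.

Lemma ports_group d (P : {group {perm W d}}) : pattern_group d (ports P).
Proof.
split=> [f g fg [p pP pf]||f g [p pP pf] [q qP qg]|f [p pP pf]].
- by exists p => // u ud; rewrite pf //; apply: eqport_act fg ud.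
- by exists 1%g; [exact: group1 | move=> u ud; rewrite actf1 // act_one].
(* The order is reversed: a product of permutations applies its left factor first, while [pmul f g]
   applies [g] first. *)
- exists (q * p)%g; first exact: groupM.
  by move=> u ud; rewrite actfM // qg // pf ?size_act // act_mul.
exists (p^-1)%g; first by rewrite groupV.
move=> u ud; rewrite act_inv -[u in LHS](iactK f) -pf ?size_iact //.
by rewrite -actfM ?size_iact // mulgV actf1 ?size_iact.
Qed.

Lemma pt_eqport n (s : {perm W n}) f :
  (forall u, size u <= n -> actf s u = act f u) -> eqport n (pt s) f.
Proof.
move=> sf; apply: act_eqport => u un; rewrite -act_pt ?sf //.
by apply/GdP; exists f.
Qed.

Lemma ports_pt n (P : {set {perm W n}}) p :
  P \subset Gd n -> p \in P -> ports P (pt p).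
Proof.
by move=> /subsetP sP pP; exists p => // u un; apply: act_pt => //; apply: sP.
Qed.

Lemma ports_self_similar m (P : {group {perm W m.+1}}) :
  P \subset Gd m.+1 -> essential P -> self_similar m (ports P).
Proof.
move=> sP eP f i [p pP pf]; have [q qP qp] := eP p pP i.
exists (pt q); first exact: ports_pt.
apply: act_eqport => u um; rewrite -act_pt ?(subsetP sP) ?(leqW um) //.
by rewrite qp // pf //= drop0.
Qed.

Lemma rho_actE f : rho (act f) = f.
Proof. exact/functional_extensionality/rho_act. Qed.

Lemma GP_ports d (P : {group {perm W d}}) g :
  GP P g <-> isAut g /\ constrained (ports P) (rho g).
Proof.
have secE w u : isAut g -> sec g w u = act (below (rho g) w) u.
  by move=> gA; rewrite {1}(isAut_act gA) sec_act.
by split=> -[gA gC]; split=> // w; have [p pP pg] := gC w; exists p => // u ud;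
  rewrite pg // secE.
Qed.

Lemma GP_act d (P : {group {perm W d}}) f :
  GP P (act f) <-> constrained (ports P) f.
Proof.
rewrite GP_ports rho_actE; split=> [[]//|fC]; split=> //; exact: act_isAut.
Qed.

Lemma tr_pt_inj n : {in Gd n &, injective (fun s => tr n (pt s))}.
Proof.
move=> s t sG tG /tr_eqP st; apply: actf_inj => u un.
by rewrite !act_pt //; apply: eqport_act st un.
Qed.

Lemma card_Gd n : #|Gd n| = 2 ^ (2 ^ n - 1).
Proof.
rewrite -card_pattern -cardsT -(card_in_imset (@tr_pt_inj n)).
congr #|pred_of_set _|; apply/setP => t; rewrite inE; apply/imsetP.
have [s sG st] := Gd_exists n (ext t); exists s => //.
by rewrite -[t in LHS]extK; apply/tr_eqP/eqport_sym/pt_eqport.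
Qed.

Lemma card_Kn d (P : {group {perm W d}}) n :
  #|Kn (GP P) n| = #|patterns_of n (constrained (ports P))|.
Proof.
have sub : {subset Kn (GP P) n <= Gd n} by move=> s; rewrite inE => /andP [].
rewrite -(card_in_imset (f := fun s => tr n (pt s))); last first.
  by move=> s t /sub sG /sub tG; apply: tr_pt_inj.
congr #|pred_of_set _|; apply/setP => t; apply/imsetP/idP => [[s]|].
  rewrite inE => /andP [sG /asbP [g [/GP_ports [gA gC] sg]]] ->.
  rewrite inE; apply/asbP; exists (rho g) => //; apply/tr_eqP/eqport_sym/pt_eqport.
  by move=> u un; rewrite sg // {1}(isAut_act gA).
rewrite inE => /asbP [f fC <-]; have [s sG sf] := Gd_exists n f.
exists s; last by apply/tr_eqP/eqport_sym/pt_eqport.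
by rewrite inE sG; apply/asbP; exists (act f); split=> //; apply/GP_act.
Qed.

(** Turns the projection of [P] back into a group of permutations, the form in which minimality of
    the pattern size is stated. *)
Lemma group_of_patterns n Q : pattern_group n Q ->
  exists2 P : {group {perm W n}}, P \subset Gd n & forall f, ports P f <-> Q f.
Proof.
move=> gQ; pose A := [set s in Gd n | asb (Q (pt s))].
have AP s : reflect (exists2 f, Q f & forall u, size u <= n -> actf s u = act f u)
    (s \in A).
  rewrite inE; apply: (iffP andP) => [[sG /asbP sQ]|[f fQ sf]].
    by exists (pt s) => // u; apply: act_pt.
  split; first by apply/GdP; exists f.
  by apply/asbP; apply: (pg_eq gQ _ fQ); apply/eqport_sym/pt_eqport.
have gA : group_set A.
  apply/group_setP; split=> [|s t /AP [f fQ sf] /AP [g gQ' tg]]; apply/AP.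
    by exists pone; [exact: (pg_one gQ) | move=> u un; rewrite actf1 // act_one].
  exists (pmul g f); first exact: (pg_mul gQ).
  by move=> u un; rewrite actfM // sf // tg ?size_act // act_mul.
exists (Group gA) => [|f]; first by apply/subsetP => s; rewrite inE => /andP [].
split=> [[s /AP [g gQ' sg] sf]|fQ].
  apply: (pg_eq gQ _ gQ'); apply: eqport_trans (pt_eqport sf).
  exact/eqport_sym/pt_eqport.
by have [s _ sf] := Gd_exists n f; exists s => //; apply/AP; exists f.
Qed.

Lemma self_similar_essential n (P : {group {perm W n.+1}}) :
  P \subset Gd n.+1 -> self_similar n (ports P) -> essential P.
Proof.
move=> sP ss p pP i; have [f [q qP qf] fp] := ss _ i (ports_pt sP pP).
exists q => // u un; rewrite qf ?(leqW un) //
  (act_pt _ (u := i :: u)) ?(subsetP sP) //=.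
by rewrite drop0; apply: eqport_act fp un.
Qed.

Lemma constrained_iff P Q f :
  (forall g, P g <-> Q g) -> constrained P f <-> constrained Q f.
Proof. by move=> PQ; split=> fC w; apply/PQ. Qed.

(** The projection is an essential pattern group of size [m.+1] whose group always contains G_P; the
    hypothesis gives the reverse inclusion, so the smaller size already defines G_P. *)
Lemma minimal_not_join m (P : {group {perm W m.+2}}) :
  P \subset Gd m.+2 -> essential P -> minimal_size P ->
  (forall f, constrained (proj m.+1 (ports P)) f -> constrained (ports P) f) -> False.
Proof.
move=> sP eP minP H; have gP := ports_group P.
have ssP := ports_self_similar sP eP.
have [R sR RQ] := group_of_patterns (proj_group gP).
have ssR : self_similar m (ports R).
  move=> f i /RQ /(proj_self_similar ssP i) [p pQ pf].
  by exists p => //; apply/RQ.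
apply: (minP m.+1 _ R sR (self_similar_essential sR ssR)); first by rewrite ltnSn.
move=> g; rewrite !GP_ports (constrained_iff _ RQ); split=> -[gA gC]; split=> //.
  exact: H.
by move=> w; apply: proj_in.
Qed.

Lemma additive_of_padd d (P : {group {perm W d}}) :
  (forall f g, ports P f -> ports P g -> ports P (padd f g)) ->
  additive_portraits (GP P).
Proof.
move=> PD; split=> [|g h /GP_ports [_ gC] /GP_ports [_ hC]].
  exists (act pone); rewrite GP_act rho_actE; split=> // w.
  exact: pg_one (ports_group P).
exists (act (padd (rho g) (rho h))); rewrite GP_act rho_actE; split=> w.
  exact: PD (gC w) (hC w).
by rewrite /padd; case: (rho g w) (rho h w) => [] [].
Qed.

(** * From Hausdorff dimension to the order of the kernel *)

Section Dimension.
Local Open Scope R_scope.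

Lemma INR_expn (a n : nat) : INR (a ^ n)%N = INR a ^ n.
Proof. by elim: n => // n IH; rewrite expnS -multE mult_INR IH. Qed.

Lemma ln2_gt0 : 0 < ln 2.
Proof. by rewrite -ln_1; apply: ln_increasing; lra. Qed.

Lemma log2_pow2 n : log2 (2 ^ n) = INR n.
Proof.
rewrite /log2 ln_pow; last lra.
by have := ln2_gt0 => ?; field; lra.
Qed.

Lemma log2_mult_pow a b n :
  0 < a -> 0 < b -> log2 (a * b ^ n) = log2 a + INR n * log2 b.
Proof.
move=> a0 b0; rewrite /log2 ln_mult ?ln_pow //; last exact: pow_lt.
by have := ln2_gt0 => ?; field; lra.
Qed.

Lemma INR_pow2_sub k j : (j <= 2 ^ k)%N -> INR (2 ^ k - j)%N = 2 ^ k - INR j.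
Proof.
by move=> jk; rewrite -minusE minus_INR; [rewrite INR_expn | apply/leP].
Qed.

Lemma liminf_limit (a : nat -> R) (l l' : R) :
  is_liminf a l ->
  (forall eps, 0 < eps -> exists N, forall n, (N <= n)%N -> Rabs (a n - l') < eps) ->
  l = l'.
Proof.
move=> [lo up] lim; case: (Rtotal_order l l') => [ll|[//|ll]]; exfalso.
  have [|N HN] := lim ((l' - l) / 2); first lra.
  have [|n [/HN /Rabs_def2 [? ?] ?]] := up ((l' - l) / 2) _ N; lra.
have [|N HN] := lim ((l - l') / 2); first lra.
have [|N' HN'] := lo ((l - l') / 2); first lra.
have := HN _ (leq_maxl N N'); have := HN' _ (leq_maxr N N').
by move=> ? /Rabs_def2; lra.
Qed.

Lemma le_pow2 k : INR k <= 2 ^ k.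
Proof.
rewrite -[2]/(INR 2) -INR_expn; apply: le_INR; apply/leP.
exact/ltnW/ltn_expl.
Qed.

Lemma ratio_limit (c lam M : R) (a : nat -> R) (m : nat) : 2 <= M ->
  (forall k, a (k + m)%N = (c + (2 ^ k - 1) * lam) / (2 ^ k * M - 1)) ->
  forall eps, 0 < eps ->
    exists N, forall n, (N <= n)%N -> Rabs (a n - lam / M) < eps.
Proof.
(* With x = 2^k, the distance to the limit is D / (M (x M - 1)), which is at most D / x because M >=
   2 and x >= 1. *)
move=> M2 aE eps eps0; pose D := Rabs (M * c - M * lam + lam).
have [k0 Hk0] := INR_unbounded (D / eps).
exists (k0 + m)%N => n kn.
have mn : (m <= n)%N by apply: leq_trans kn; rewrite leq_addl.
rewrite -(subnK mn) aE; set k := (n - m)%N.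
have kk : (k0 <= k)%N by rewrite leq_subRL // addnC.
have xk : D / eps < 2 ^ k.
  apply: Rlt_le_trans Hk0 _; apply: Rle_trans (le_pow2 k).
  by apply: le_INR; apply/leP.
have x1 : 1 <= 2 ^ k by apply: pow_R1_Rle; lra.
move: (2 ^ k) xk x1 => x xD x1.
have Mx : x <= x * M - 1 by nra.
have -> : (c + (x - 1) * lam) / (x * M - 1) - lam / M
    = (M * c - M * lam + lam) / (M * (x * M - 1)) by field; split; nra.
rewrite {1}/Rdiv Rabs_mult Rabs_inv -/D (Rabs_pos_eq (M * _)); last by nra.
apply: (Rmult_lt_reg_r (M * (x * M - 1))); first by nra.
have -> : D * / (M * (x * M - 1)) * (M * (x * M - 1)) = D by field; split; nra.
have : D < x * eps.
  have -> : D = D / eps * eps by field; lra.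
  exact: Rmult_lt_compat_r.
have D0 : 0 <= D := Rabs_pos _.
have : x * eps <= M * (x * M - 1) * eps by apply: Rmult_le_compat_r; nra.
lra.
Qed.

(** By [card_constrained] the ratios converge to log2 |K| / 2^(m+1), so the liminf is this limit;
    equating it with 1 - 2 / 2^(m+1) gives log2 |K| = 2^(m+1) - 2. *)
Lemma ker_card_of_Hdim m (P : {group {perm W m.+2}}) :
  P \subset Gd m.+2 -> essential P ->
  Hdim_is (GP P) (1 - 2 / 2 ^ m.+1) ->
  ker_card m.+1 (ports P) = (2 ^ (2 ^ m.+1 - 2))%N.
Proof.
move=> sP eP dimP; have gP := ports_group P; have ssP := ports_self_similar sP eP.
set kap := ker_card _ _; pose c := #|patset m.+1 (proj m.+1 (ports P))|.
have c0 : 0 < INR c.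
  apply/lt_0_INR/ltP/card_gt0P; exists (tr m.+1 pone).
  apply/tr_patset; first exact: proj_group.
  exact/proj_in/(pg_one gP).
have kap0 : 0 < INR kap.
  apply/lt_0_INR/ltP/card_gt0P; exists (tr m.+2 pone).
  apply/patsetP; apply: (ker_eq gP _ (ker_one gP)); exact/eqport_sym/ext_tr.
have pow2 n : (0 < 2 ^ n)%N by rewrite expn_gt0.
have M2 : 2 <= 2 ^ m.+1.
  by have : 1 <= 2 ^ m by [apply: pow_R1_Rle; lra]; simpl; lra.
have seqE k : hdim_seq (GP P) (k + m.+1) =
    (log2 (INR c) + (2 ^ k - 1) * log2 (INR kap)) / (2 ^ k * 2 ^ m.+1 - 1).
  rewrite /hdim_seq card_Kn card_Gd (card_constrained gP ssP) -/c -/kap.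
  rewrite -multE mult_INR !INR_expn log2_mult_pow // log2_pow2 !INR_pow2_sub //.
  by rewrite -[(k + _)%N]/(Nat.add k m.+1) pow_add.
have e := liminf_limit dimP (ratio_limit M2 seqE).
have : log2 (INR kap) = 2 ^ m.+1 - 2.
  have -> : log2 (INR kap) = log2 (INR kap) / 2 ^ m.+1 * 2 ^ m.+1 by field; lra.
  by rewrite -e; field; lra.
have M2n : (2 <= 2 ^ m.+1)%N by rewrite expnS leq_pmulr.
rewrite -[X in _ - X]/(INR 2) -INR_pow2_sub // -(log2_pow2 (_ - _)).
move=> /(congr1 (Rmult^~ (ln 2))).
have := ln2_gt0 => l2; rewrite /log2 /Rdiv !Rmult_assoc Rinv_l; last lra.
rewrite !Rmult_1_r => /ln_inv eq; apply: INR_eq.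
by rewrite INR_expn; apply: eq => //; apply: pow_lt; lra.
Qed.

End Dimension.

Theorem theorem4 (d : nat) (P : {group {perm W d}}) :
  (2 <= d)%N ->
  P \subset Gd d ->
  essential P ->
  minimal_size P ->
  Hdim_is (GP P) (Rminus 1 (Rdiv 2 (pow 2 (d - 1)))) ->
  additive_portraits (GP P).
Proof.
case: d P => [|[|m]] // P _ sP eP minP.
rewrite subn1 => /(ker_card_of_Hdim sP eP) cardP.
have gP := ports_group P; have ssP := ports_self_similar sP eP.
apply: additive_of_padd.
(* Closure under joins contradicts minimality; otherwise the projection has full last-level kernel
   and is therefore the whole of G(m+1). *)
case: (kernel_dichotomy gP ssP cardP) => [kQ|PJ]; last first.
  by case: (minimal_not_join sP eP minP (constrained_of_join gP ssP PJ)).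
apply: (pattern_padd gP _ cardP).
exact: (full_of_kernel (proj_group gP) (proj_self_similar ssP) kQ).
Qed.
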